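(* Continuity of the value function of a zero-sum game fails in general under weak or setwise convergence of information structures: there exist a two-player zero-sum game $g$ satisfying Assumptions A2 and A4, a fixed prior $\zeta$, and a sequence of information structures $\mu_n$ with $\mathbb{X}$-marginal $\zeta$ converging weakly to an information structure $\mu$ with $\mathbb{X}$-marginal $\zeta$ such that $J^*(g,\mu_n)\not\to J^*(g,\mu)$; and likewise there exist such examples in which $\mu_n\to\mu$ setwise but $J^*(g,\mu_n)\not\to J^*(g,\mu)$.
   Context: $\mathbb{X},\mathbb{Y}^1,\mathbb{Y}^2$ are standard Borel spaces. An information structure is a probability measure $\mu$ on $\mathbb{X}\times\mathbb{Y}^1\times\mathbb{Y}^2$; its $\mathbb{X}$-marginal is the prior. A zero-sum game is $g=(c,\mathbb{U}^1,\mathbb{U}^2)$ with standard Borel action spaces and measurable cost $c:\mathbb{X}\times\mathbb{U}^1\times\mathbb{U}^2\to\mathbb{R}$; policies are measurable $\gamma^i:\mathbb{Y}^i\to\mathbb{U}^i$; $J(g,\mu,\gamma^1,\gamma^2)=\int c(x,\gamma^1(y^1),\gamma^2(y^2))\,d\mu$, Player 1 minimizes and Player 2 maximizes, and $J^*(g,\mu)$ is the value at a saddle-point equilibrium. Weak convergence: $\int f d\mu_n\to\int f d\mu$ for all bounded continuous $f$; setwise convergence: for all bounded measurable $f$ (equivalently $\mu_n(A)\to\mu(A)$ for all Borel $A$). A2: the cost is continuous and bounded. A4: each action space is compact. *)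

(* Defs.v *)
From HB Require Import structures.
From mathcomp Require Import all_boot all_order all_algebra.
From mathcomp Require Import all_classical all_reals all_analysis.
Set Implicit Arguments. Unset Strict Implicit. Unset Printing Implicit Defensive.
Import Order.TTheory GRing.Theory Num.Theory.
Import numFieldNormedType.Exports.
Local Open Scope classical_set_scope.
Local Open Scope ring_scope.

(* Concrete setting: X = Y^1 = Y^2 = R (Borel), so an information structure is
   a probability measure on (X * Y^1) * Y^2 = (R * R) * R; a point is
   z = ((x, y1), y2).  Action spaces are subsets U^1, U^2 of R. *)

Record zs_game (R : realType) := ZSGame {
  cost : R -> R -> R -> R;
  act1 : set R;
  act2 : set R
}.

Definition A2 (R : realType) (g : zs_game R) : Prop :=
  {within [set z : (R * R) * R | act1 g z.1.2 /\ act2 g z.2],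
     continuous (fun z : (R * R) * R => cost g z.1.1 z.1.2 z.2)} /\
  exists M : R, forall x u1 u2, act1 g u1 -> act2 g u2 -> `|cost g x u1 u2| <= M.

Definition A4 (R : realType) (g : zs_game R) : Prop :=
  compact (act1 g) /\ compact (act2 g).

Definition policy (R : realType) (U : set R) (gam : R -> R) : Prop :=
  measurable_fun setT gam /\ forall y, U (gam y).

Definition Jcost (R : realType) (g : zs_game R)
  (mu : probability ((R * R) * R)%type R) (g1 g2 : R -> R) : R :=
  Rintegral mu setT (fun z : (R * R) * R => cost g z.1.1 (g1 z.1.2) (g2 z.2)).

Definition saddle_point (R : realType) (g : zs_game R)
  (mu : probability ((R * R) * R)%type R) (g1 g2 : R -> R) : Prop :=
  [/\ policy (act1 g) g1, policy (act2 g) g2,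
      (forall g1', policy (act1 g) g1' -> Jcost g mu g1 g2 <= Jcost g mu g1' g2) &
      (forall g2', policy (act2 g) g2' -> Jcost g mu g1 g2' <= Jcost g mu g1 g2)].

Definition saddle_value (R : realType) (g : zs_game R)
  (mu : probability ((R * R) * R)%type R) (v : R) : Prop :=
  exists g1 g2, saddle_point g mu g1 g2 /\ Jcost g mu g1 g2 = v.

Definition x_marginal (R : realType) (mu : probability ((R * R) * R)%type R)
  (zeta : probability R R) : Prop :=
  forall A : set R, measurable A -> mu ((A `*` setT) `*` setT) = zeta A.

Definition weak_conv (R : realType) (mu_ : nat -> probability ((R * R) * R)%type R)
  (mu : probability ((R * R) * R)%type R) : Prop :=
  forall f : (R * R) * R -> R, continuous f -> (exists M : R, forall z, `|f z| <= M) ->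
    (fun n => Rintegral (mu_ n) setT f) @ \oo --> Rintegral mu setT f.

Definition setwise_conv (R : realType) (mu_ : nat -> probability ((R * R) * R)%type R)
  (mu : probability ((R * R) * R)%type R) : Prop :=
  forall A : set ((R * R) * R), measurable A -> (fun n => mu_ n A) @ \oo --> mu A.

(* Main.v *)
Require Import Defs.
From HB Require Import structures.
From mathcomp Require Import all_boot all_order all_algebra.
From mathcomp Require Import all_classical all_reals all_analysis.
From mathcomp Require Import measurable_realfun ring lra.
Set Implicit Arguments. Unset Strict Implicit. Unset Printing Implicit Defensive.
Import Order.TTheory GRing.Theory Num.Theory.
Import numFieldNormedType.Exports.
Local Open Scope classical_set_scope.
Local Open Scope ring_scope.

(** One example serves both halves, since setwise convergence of these laws
    comes with convergence of integrals of all bounded measurable functions.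
    Let Y be uniform on [0, 1[ and r_n(y) = +-1 the n-th Rademacher function
    (the sign given by a binary digit of y).  Under mu_n the state is r_n(Y) and
    Player 1 observes Y, hence knows the state; under mu the state is a fair
    coin independent of Y.  Every bounded measurable f splits on
    {-1, 1} * R * {0} as f0(y) + x f1(y), so the integral of f under mu_n differs
    from the one under mu by E[f1(Y) r_n(Y)].  The r_n being orthonormal, these
    are Fourier coefficients, which tend to 0 by Bessel's inequality.
    With cost x u1, u1 in [-1, 1], and a dummy Player 2, the value is -1 under
    every mu_n (play u1 = - r_n(y)) and 0 under mu. *)

(** * Bounded measurable functions and their integrals under a probability *)

Section BoundedMeasurable.
Context {d : measure_display} {T : measurableType d} {R : realType}.
Implicit Types f g : T -> R.

(** No measure occurs here: such functions are integrable under every probability and stable under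
    ring operations, so one condition covers all integrability side goals. *)
Definition bmeasurable f :=
  measurable_fun setT f /\ exists M : R, forall x, `|f x| <= M.

Lemma bmeasurable_cst (c : R) : bmeasurable (fun=> c).
Proof. by split; [exact: measurable_cst|exists `|c|]. Qed.

Lemma bmeasurableD f g : bmeasurable f -> bmeasurable g ->
  bmeasurable (fun x => f x + g x).
Proof.
move=> [mf [M fM]] [mg [N gN]]; split; first exact: measurable_funD.
by exists (M + N) => x; rewrite (le_trans (ler_normD _ _))// lerD.
Qed.

Lemma bmeasurableM f g : bmeasurable f -> bmeasurable g ->
  bmeasurable (fun x => f x * g x).
Proof.
move=> [mf [M fM]] [mg [N gN]]; split; first exact: measurable_funM.
by exists (M * N) => x; rewrite normrM ler_pM.
Qed.

Lemma bmeasurableZ (c : R) f : bmeasurable f -> bmeasurable (fun x => c * f x).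
Proof. exact/bmeasurableM/bmeasurable_cst. Qed.

Lemma bmeasurableB f g : bmeasurable f -> bmeasurable g ->
  bmeasurable (fun x => f x - g x).
Proof.
move=> bf bg; rewrite (_ : (fun x => _) = fun x => f x + -1 * g x).
  exact/bmeasurableD/bmeasurableZ.
by apply/funext => x; rewrite mulN1r.
Qed.

Lemma bmeasurable_indic (A : set T) : measurable A -> bmeasurable (\1_A).
Proof.
move=> mA; split; first exact: measurable_indic.
by exists 1 => x; rewrite indicE; case: (_ \in _); rewrite ?normr1 ?normr0.
Qed.

Variable P : probability T R.

Lemma bmeasurable_integrable f : bmeasurable f -> P.-integrable setT (EFin \o f).
Proof.
move=> [mf [M fM]]; apply: measurable_bounded_integrable => //.
  by rewrite -ge0_fin_numE// fin_num_measure.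
exists M; split; first exact: num_real.
by move=> N MN x _; exact: le_trans (fM x) (ltW MN).
Qed.

Local Notation E f := (Rintegral P setT f).

Lemma bRintegralD f g : bmeasurable f -> bmeasurable g ->
  E (fun x => f x + g x) = E f + E g.
Proof. by move=> bf bg; rewrite RintegralD//; exact: bmeasurable_integrable. Qed.

Lemma bRintegralB f g : bmeasurable f -> bmeasurable g ->
  E (fun x => f x - g x) = E f - E g.
Proof. by move=> bf bg; rewrite RintegralB//; exact: bmeasurable_integrable. Qed.

Lemma bRintegralZ (c : R) f : bmeasurable f -> E (fun x => c * f x) = c * E f.
Proof. by move=> bf; rewrite RintegralZl//; exact: bmeasurable_integrable. Qed.

Lemma bRintegral_cst (c : R) : E (fun=> c) = c.
Proof. by rewrite Rintegral_cst//= probability_setT mulr1. Qed.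

Lemma bRintegral_le f g : bmeasurable f -> bmeasurable g ->
  (forall x, f x <= g x) -> E f <= E g.
Proof. by move=> bf bg fg; rewrite le_Rintegral//; exact: bmeasurable_integrable. Qed.

End BoundedMeasurable.

Lemma bmeasurable_comp d d' (T : measurableType d) (T' : measurableType d')
    (R : realType) (f : T' -> R) (phi : T -> T') :
  bmeasurable f -> measurable_fun setT phi -> bmeasurable (f \o phi).
Proof.
move=> [mf [M fM]] mphi; split; first exact: measurableT_comp.
by exists M => x; exact: fM.
Qed.

Lemma Rintegral_distribution d d' (T : measurableType d) (T' : measurableType d')
    (R : realType) (P : probability T R) (X : {mfun T >-> T'}) (f : T' -> R) :
  bmeasurable f ->
  Rintegral (distribution P X) setT f = Rintegral P setT (f \o X).
Proof.
move=> bf; rewrite /Rintegral integral_distribution//.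
- by apply/measurable_EFinP; case: bf.
- exact/bmeasurable_integrable/bmeasurable_comp.
Qed.

(** * Bessel's inequality for an orthonormal sequence of bounded functions *)

Section Bessel.
Context {d : measure_display} {T : measurableType d} {R : realType}.
Variables (P : probability T R) (rho : nat -> T -> R) (h : T -> R).
Hypothesis brho : forall n, bmeasurable (rho n).
Hypothesis bh : bmeasurable h.
Local Notation E f := (Rintegral P setT f).
Hypothesis rho_normal : forall n, E (fun x => rho n x * rho n x) = 1.
Hypothesis rho_orth : forall n m, (n < m)%N -> E (fun x => rho n x * rho m x) = 0.

(** The Fourier coefficients of [h] along [rho]. *)
Let c n := E (fun x => h x * rho n x).

(* [S n] is [h] minus its projection onto the first [n] functions [rho]. *)
Let S : nat -> T -> R := fix S n :=
  if n is m.+1 then fun x => S m x - c m * rho m x else h.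

Let bS n : bmeasurable (S n).
Proof. by elim: n => //= n IH; exact/bmeasurableB/bmeasurableZ. Qed.

(** The terms subtracted so far involve only indices below [m], hence are orthogonal to [rho m]. *)
Let S_rho n m : (n <= m)%N -> E (fun x => S n x * rho m x) = c m.
Proof.
elim: n => //= n IH nm.
under eq_Rintegral do rewrite mulrBl -mulrA.
rewrite bRintegralB ?bRintegralZ ?rho_orth ?mulr0 ?subr0 ?IH// 1?ltnW//.
- exact: bmeasurableM.
- exact: bmeasurableM.
- exact/bmeasurableZ/bmeasurableM.
Qed.

(** Pythagoras: when the square of [S n.+1] is expanded, the cross term contributes [- 2 * c n ^+ 2]
    by [S_rho] with m = n, and the last term [c n ^+ 2] by normalization. *)
Let S_sq n : E (fun x => S n x * S n x) =
  E (fun x => h x * h x) - \sum_(0 <= i < n) c i ^+ 2.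
Proof.
elim: n => [|n IH]; first by rewrite big_geq ?subr0.
rewrite big_nat_recr//= opprD addrA -IH.
rewrite (_ : (fun x => _) = fun x =>
  (S n x * S n x - (2 * c n) * (S n x * rho n x)) + c n ^+ 2 * (rho n x * rho n x));
  last by apply/funext => x; ring.
have b1 := bmeasurableM (bS n) (bS n).
have b2 := bmeasurableZ (2 * c n) (bmeasurableM (bS n) (brho n)).
have b3 := bmeasurableZ (c n ^+ 2) (bmeasurableM (brho n) (brho n)).
rewrite (bRintegralD P (bmeasurableB b1 b2) b3) (bRintegralB P b1 b2).
rewrite !bRintegralZ ?S_rho ?rho_normal//; try exact: bmeasurableM.
ring.
Qed.

(** The left side of [S_sq] is nonnegative, which bounds the partial sums of the squares (Bessel);
    the series therefore converges and its terms vanish in the limit. *)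
Lemma cvg_fourier_coef : c @ \oo --> (0 : R).
Proof.
have bnd n : \sum_(0 <= i < n) c i ^+ 2 <= E (fun x => h x * h x).
  rewrite -subr_ge0 -S_sq; apply: Rintegral_ge0 => x _.
  by rewrite -expr2 sqr_ge0.
have csq : (fun n => c n ^+ 2) @ \oo --> (0 : R).
  apply: cvg_series_cvg_0; apply: nondecreasing_is_cvgn.
    by apply/nondecreasing_seqP => n; rewrite /series/= big_nat_recr//= lerDl sqr_ge0.
  by exists (E (fun x => h x * h x)) => _ [n _ <-]; exact: bnd.
apply/cvgr0Pnorm_lt => e e0.
have e2 : 0 < e ^+ 2 by rewrite exprn_gt0.
move/cvgr0Pnorm_lt : csq => /(_ _ e2); apply: filterS => n.
by rewrite normrX ltr_pXn2r// ?nnegrE// ltW.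
Qed.

End Bessel.

(** * The uniform law on [0, 1[ and its invariance under rotation *)

Section Rotation.
Context {R : realType}.
Local Notation leb := (@lebesgue_measure R).

(* [measurableTypeR R], the domain of [lebesgue_measure], has another display than
   [R]; the explicit arguments below keep the canonical structure of [R] from
   being inferred instead. *)
Lemma measurable_translation (s : R) :
  @measurable_fun _ _ (measurableTypeR R) (measurableTypeR R) setT (fun y => y + s).
Proof. exact: (measurable_funD (@measurable_id _ R setT) (measurable_cst s)). Qed.

(** By uniqueness of Lebesgue measure it is enough to compare the two measures on the intervals ]a,
    b]. *)
Lemma lebesgue_measure_translation (s : R) (A : set (measurableTypeR R)) :
  measurable A -> leb ((fun y => y + s) @^-1` A) = leb A.
Proof.
move=> mA.
pose t : {mfun measurableTypeR R >-> measurableTypeR R} :=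
  @mfun_Sub _ _ (measurableTypeR R) (measurableTypeR R) _ (mem_set (measurable_translation s)).
apply/esym; rewrite (@lebesgue_measure_unique R (pushforward leb t)) //.
move=> _ [[a b]] _ <-.
rewrite [RHS](_ : _ = leb `]a - s, b - s]%classic).
  rewrite !lebesgue_measure_itv/= !lte_fin ltrD2r; case: ifP => // _.
  by rewrite -!EFinB; congr EFin; ring.
congr (leb _); apply/seteqP; split => y /=;
  by rewrite !in_itv/= ltrBlDr lerBrDr.
Qed.

Let m01 : measurable (`[0, 1[%classic : set (measurableTypeR R)).
Proof. exact: measurable_itv. Qed.

Definition unif01 : set (measurableTypeR R) -> \bar R := mrestr leb m01.

HB.instance Definition _ := Measure.on unif01.

Let unif01_setT : unif01 setT = 1%E.
Proof.
rewrite /unif01 /mrestr setTI lebesgue_measure_itv/= lte_fin ltr01.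
by rewrite -EFinB subr0.
Qed.

HB.instance Definition _ := Measure_isProbability.Build _ _ R unif01 unif01_setT.

(* Addition of [s] modulo 1 on [[0, 1[]. *)
Definition rotation (s y : R) : R := if y < 1 - s then y + s else y + (s - 1).

Lemma measurable_rotation s :
  @measurable_fun _ _ (measurableTypeR R) (measurableTypeR R) setT (rotation s).
Proof.
apply: measurable_fun_ifT.
- exact: (measurable_fun_ltr (@measurable_id _ R setT) (measurable_cst (1 - s))).
- exact: measurable_translation.
- exact: measurable_translation.
Qed.

Lemma unif01_rotation s (A : set (measurableTypeR R)) : 0 <= s <= 1 ->
  measurable A -> unif01 (rotation s @^-1` A) = unif01 A.
Proof.
move=> /andP[s0 s1] mA; rewrite /unif01 /mrestr.
have mi (a b : R) : measurable (`[a, b[%classic : set (measurableTypeR R)).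
  exact: measurable_itv.
have mt a b t : measurable ((fun y => y + t) @^-1` (A `&` `[a, b[%classic) : set (measurableTypeR R)).
  rewrite -[X in measurable X]setTI; apply: measurable_translation => //.
  exact: measurableI.
(* The rotation translates [0, 1 - s[ onto [s, 1[ and [1 - s, 1[ onto [0, s[; each piece is then
   handled by translation invariance. *)
rewrite (_ : _ `&` _ = (fun y => y + s) @^-1` (A `&` `[s, 1[%classic) `|`
  (fun y => y + (s - 1)) @^-1` (A `&` `[0, s[%classic)); last first.
  apply/seteqP; split=> y /=; rewrite !in_itv/= /rotation.
    by case: ltP => ys [Ay /andP[y0 y1]]; [left|right]; split=> //; lra.
  by case=> -[Ay yi]; case: ltP => ys; split => //; lra.
rewrite measureU//; last first.
  by apply/seteqP; split=> y //= -[[_ +] [_]]; rewrite !in_itv/=; lra.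
transitivity (leb (A `&` `[s, 1%R[) + leb (A `&` `[0%R, s[))%E.
  by congr (_ + _)%E; apply: lebesgue_measure_translation; exact: measurableI.
rewrite -measureU; [|exact: measurableI|exact: measurableI|].
  congr (leb _); apply/seteqP; split => y /=; rewrite !in_itv/=.
    by case=> -[Ay yi]; split=> //; lra.
  by case=> Ay yi; case: (ltP y s) => ys; [right|left]; split => //; lra.
by apply/seteqP; split=> y //= -[[_ +] [_]]; rewrite !in_itv/=; lra.
Qed.

Lemma Rintegral_rotation s (h : measurableTypeR R -> R) : 0 <= s <= 1 ->
  bmeasurable h -> Rintegral unif01 setT (h \o rotation s) = Rintegral unif01 setT h.
Proof.
move=> s01 bh.
pose t : {mfun measurableTypeR R >-> measurableTypeR R} :=
  @mfun_Sub _ _ (measurableTypeR R) (measurableTypeR R) _ (mem_set (measurable_rotation s)).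
rewrite -[LHS](@Rintegral_distribution _ _ _ _ _ unif01 t h bh).
congr fine; apply: eq_measure_integral => A mA _.
exact: unif01_rotation.
Qed.

End Rotation.

(** * Measurability through countable partitions, and of continuous functions of three variables *)

(** The type [I] carries no sigma-algebra: a preimage is a union of fibers of [phi], countable
    because [I] is. *)
Lemma measurable_countable_fibers d d' (T : measurableType d)
    (T' : measurableType d') (I : countType) (phi : T -> I) (g : I -> T') :
  (forall i, measurable (phi @^-1` [set i])) -> measurable_fun setT (g \o phi).
Proof.
move=> mphi _ B mB; rewrite setTI.
rewrite (_ : _ @^-1` B =
    \bigcup_i (if g i \in B then phi @^-1` [set i] else set0)).
  by apply: countable_bigcupT_measurable => // i; case: ifP.
apply/seteqP; split => [t Bt|t [i _]] /=.
  by exists (phi t) => //; rewrite mem_set.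
by case: ifPn => // /set_mem Bi /= ti; rewrite ti.
Qed.

Lemma measurable_floor_fiber (R : realType) (c : R) (k : int) :
  measurable [set y : R | Num.floor (c * y) = k].
Proof.
rewrite (_ : [set _ | _] = (fun y => c * y) @^-1` `[k%:~R, (k + 1)%:~R[%classic).
  rewrite -[X in measurable X]setTI.
  by apply: (measurable_funM (measurable_cst c) (@measurable_id _ R setT)).
apply/seteqP; split => y /=; rewrite in_itv/= -floor_eq; first by move=> ->.
by move/eqP.
Qed.

(* [f] is the pointwise limit of its values on finer and finer grids, and a
   function of the grid cell takes countably many values. *)
Lemma continuous_measurable_fun3 (R : realType) (f : (R * R) * R -> R) :
  continuous f -> measurable_fun setT f.
Proof.
move=> cf.
pose phi (n : nat) (z : (R * R) * R) :=
  (Num.floor (n.+1%:R * z.1.1), Num.floor (n.+1%:R * z.1.2),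
   Num.floor (n.+1%:R * z.2)).
pose g (n : nat) (k : int * int * int) : (R * R) * R :=
  (k.1.1%:~R / n.+1%:R, k.1.2%:~R / n.+1%:R, k.2%:~R / n.+1%:R).
apply: (@measurable_fun_cvg _ _ _ setT (fun n => (f \o g n) \o phi n)).
  move=> n; apply: measurable_countable_fibers => -[[k1 k2] k3].
  rewrite (_ : _ @^-1` _ = ([set y | Num.floor (n.+1%:R * y) = k1] `*`
    [set y | Num.floor (n.+1%:R * y) = k2]) `*`
    [set y | Num.floor (n.+1%:R * y) = k3]).
    by apply: measurableX; [apply: measurableX|]; exact: measurable_floor_fiber.
  by apply/seteqP; split => [[[x y] z] /= [-> -> ->]|[[x y] z] /= [[<- <-] <-]].
have cvgfl (x : R) : (Num.floor (n.+1%:R * x))%:~R / n.+1%:R @[n --> \oo] --> x.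
  apply/cvgrPdist_le => e e0; near=> n.
  have n0 : (0 : R) < n.+1%:R by rewrite ltr0n.
  have /andP[h1 h2] := floor_itv (n.+1%:R * x).
  rewrite intrD in h2.
  have -> : x - (Num.floor (n.+1%:R * x))%:~R / n.+1%:R =
    (n.+1%:R * x - (Num.floor (n.+1%:R * x))%:~R) / n.+1%:R by field; rewrite gt_eqF.
  rewrite normrM normfV ger0_norm ?subr_ge0// gtr0_norm//.
  (* The numerator is a fractional part, so rounding to the grid costs at most one mesh. *)
  apply: (@le_trans _ _ (n.+1%:R^-1)).
    by rewrite ler_pdivrMr// mulVf ?gt_eqF//; lra.
  by apply: ltW; near: n; exact: (near_infty_natSinv_lt (PosNum e0)).
move=> [[x y] z] _ /=.
apply: (@continuous_cvg _ _ _ _ _ _ f); first exact: cf.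
exact: (cvg_pair (cvg_pair (cvgfl x) (cvgfl y)) (cvgfl z)).
Unshelve. all: by end_near.
Qed.

(** * Rademacher functions: periodicity, centering, orthogonality *)

Section Rademacher.
Context {R : realType}.

(** On [0, 1[ the parity of the floor is binary digit n + 1 of [y]. The formula makes sense on the
    whole line, with period 2^-n, so shifts need no reduction modulo 1. *)
Definition rademacher n (y : R) : R := (-1) ^ Num.floor (2 ^+ n.+1 * y).

Lemma rademacher_sqr n y : rademacher n y * rademacher n y = 1.
Proof. by rewrite /rademacher -exprzMl ?unitrN1// mulrNN mulr1 exp1rz. Qed.

Lemma rademacher_pm1 n y : rademacher n y = 1 \/ rademacher n y = -1.
Proof.
have /eqP := rademacher_sqr n y; rewrite -expr2 sqrf_eq1.
by case/orP => /eqP ->; [left|right].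
Qed.

Lemma bmeasurable_rademacher n :
  @bmeasurable _ (measurableTypeR R) R (rademacher n).
Proof.
split.
  apply: (@measurable_countable_fibers _ _ (measurableTypeR R) R _
    (fun y => Num.floor (2 ^+ n.+1 * y)) (fun z => (-1) ^ z)) => k.
  exact: measurable_floor_fiber.
by exists 1 => y; case: (rademacher_pm1 n y) => ->; rewrite ?normrN normr1.
Qed.

Lemma rademacherD n y s (k : int) : 2 ^+ n.+1 * s = k%:~R ->
  rademacher n (y + s) = rademacher n y * (-1) ^ k.
Proof.
move=> sk; rewrite /rademacher mulrDr sk floorDrz ?intr_int// intrKfloor.
by rewrite exprzDr ?unitrN1.
Qed.

Lemma expN1_pow2 k : (-1 : R) ^ ((2 ^ k.+1)%N : int) = 1.
Proof. by rewrite -exprnP -signr_odd oddX. Qed.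

(** Reduction modulo 1 is invisible: shifting by 1 adds the even integer 2^(n+1) to the floor. *)
Lemma rademacher_rotation n s y :
  rademacher n (rotation s y) = rademacher n (y + s).
Proof.
rewrite /rotation; case: ifP => // _.
rewrite -[RHS](_ : rademacher n (y + (s - 1) + 1) = _); last by congr rademacher; ring.
rewrite (@rademacherD _ _ 1 (2 ^ n.+1)%N) ?expN1_pow2 ?mulr1//.
by rewrite -pmulrn natrX.
Qed.

Lemma rademacher_half n y :
  rademacher n (rotation (2 ^- n.+1) y) = - rademacher n y.
Proof.
rewrite rademacher_rotation (@rademacherD _ _ _ 1) ?expr1z ?mulrN1//.
by rewrite divff// expf_neq0// pnatr_eq0.
Qed.

Lemma rademacher_finer n m y : (n < m)%N ->
  rademacher m (rotation (2 ^- n.+1) y) = rademacher m y.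
Proof.
move=> nm; rewrite rademacher_rotation.
(* The floor moves by 2^(m-n), which is even since n < m; the exponent is written as a successor to
   match [expN1_pow2]. *)
rewrite (@rademacherD _ _ _ (2 ^ (m - n.+1).+1)%N) ?expN1_pow2 ?mulr1//.
rewrite -subSn// subSS -pmulrn natrX.
have -> : m.+1 = ((m - n) + n.+1)%N by rewrite addnS subnK// ltnW.
by rewrite exprD mulfK// expf_neq0// pnatr_eq0.
Qed.

Let half01 n : 0 <= (2 ^- n.+1 : R) <= 1.
Proof.
by rewrite invr_ge0 exprn_ge0//= invf_le1 ?exprn_gt0// exprn_ege1// ler1n.
Qed.

(** Rotation by half a period preserves the integral and flips its sign. *)
Lemma Rintegral_rademacher n : Rintegral (@unif01 R) setT (rademacher n) = 0.
Proof.
have := Rintegral_rotation (half01 n) (bmeasurable_rademacher n).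
rewrite (_ : _ \o _ = fun y => -1 * rademacher n y); last first.
  by apply/funext => y /=; rewrite rademacher_half mulN1r.
rewrite bRintegralZ; last exact: bmeasurable_rademacher.
lra.
Qed.

(* Rotating by half a period of [rademacher n] flips its sign and leaves the
   finer [rademacher m] unchanged. *)
Lemma rademacher_orthogonal n m : (n < m)%N ->
  Rintegral (@unif01 R) setT (fun y => rademacher n y * rademacher m y) = 0.
Proof.
move=> nm.
have bh := bmeasurableM (bmeasurable_rademacher n) (bmeasurable_rademacher m).
have := Rintegral_rotation (half01 n) bh.
rewrite (_ : _ \o _ = fun y => -1 * (rademacher n y * rademacher m y)); last first.
  by apply/funext => y /=; rewrite rademacher_half rademacher_finer// mulN1r mulNr.
rewrite bRintegralZ//; lra.
Qed.

Lemma cvg_rademacher_coef (h : measurableTypeR R -> R) : bmeasurable h ->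
  Rintegral (@unif01 R) setT (fun y => h y * rademacher n y) @[n --> \oo] --> (0 : R).
Proof.
move=> bh; apply: cvg_fourier_coef => // [n|n|n m].
- exact: bmeasurable_rademacher.
- rewrite [X in Rintegral _ _ X](_ : _ = fun=> 1).
    exact: bRintegral_cst.
  by apply/funext => y; exact: rademacher_sqr.
- exact: rademacher_orthogonal.
Qed.

End Rademacher.

(** * The information structures and their integrals *)

Section Example.
Context {R : realType}.
Local Notation T := (measurableTypeR R).
Local Notation P := (@unif01 R).
Local Notation E f := (Rintegral P setT f).
Implicit Types f : (R * R) * R -> R.

(** Player 2 always observes 0. The sample space is a parameter because [informative] is built from
    one uniform variable and [uninformative] from two. *)
Definition observation d (S : measurableType d) (x y : S -> R) (s : S) :
  (R * R) * R := ((x s, y s), 0).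

Lemma measurable_observation d (S : measurableType d) (x y : S -> R) :
  measurable_fun setT x -> measurable_fun setT y ->
  measurable_fun setT (observation x y).
Proof.
move=> mx my; apply/measurable_fun_pairP; split => /=; last exact: measurable_cst.
by apply/measurable_fun_pairP; split.
Qed.

Let measurable_idR : measurable_fun setT (idfun : T -> R).
Proof. exact: (@measurable_id _ T setT). Qed.

Definition informative (n : nat) : probability ((R * R) * R)%type R :=
  distribution P (mfun_Sub (mem_set (measurable_observation
    (proj1 (bmeasurable_rademacher n)) measurable_idR))).

Let measurable_coin :
  measurable_fun setT ((rademacher 0 : T -> R) \o (fst : T * T -> T)).
Proof.
exact: measurableT_comp (proj1 (bmeasurable_rademacher 0)) (@measurable_fst _ _ T T).
Qed.

Let measurable_sndR : measurable_fun setT (snd : T * T -> R).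
Proof. exact: (@measurable_snd _ _ T T). Qed.

(** The first uniform variable tosses the coin, through its leading binary digit; the second,
    independent of it, is what Player 1 observes. *)
Definition uninformative : probability ((R * R) * R)%type R :=
  distribution (P \x P)%E (mfun_Sub (mem_set (measurable_observation
    measurable_coin measurable_sndR))).

(** With [skew_part], the coefficients f0 and f1 of f0(y) + x f1(y): the even and odd parts of [f]
    in the state. *)
Definition sym_part (f : (R * R) * R -> R) (y : R) : R :=
  2^-1 * (f ((1, y), 0) + f ((-1, y), 0)).

Definition skew_part (f : (R * R) * R -> R) (y : R) : R :=
  2^-1 * (f ((1, y), 0) - f ((-1, y), 0)).

Lemma sym_skew_decomposition f n (s y : R) :
  f ((rademacher n s, y), 0) = sym_part f y + skew_part f y * rademacher n s.
Proof.
by rewrite /sym_part /skew_part; case: (rademacher_pm1 n s) => ->; field.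
Qed.

Let bmeasurable_slice f (x : R) : bmeasurable f ->
  @bmeasurable _ T R (fun y => f ((x, y), 0)).
Proof.
move=> bf; have mo := measurable_observation (measurable_cst x) measurable_idR.
exact: (bmeasurable_comp bf mo).
Qed.

Lemma bmeasurable_sym_part f : bmeasurable f -> @bmeasurable _ T R (sym_part f).
Proof. by move=> bf; apply/bmeasurableZ/bmeasurableD; exact: bmeasurable_slice. Qed.

Lemma bmeasurable_skew_part f : bmeasurable f -> @bmeasurable _ T R (skew_part f).
Proof. by move=> bf; apply/bmeasurableZ/bmeasurableB; exact: bmeasurable_slice. Qed.

Lemma Rintegral_informative n f : bmeasurable f ->
  Rintegral (informative n) setT f =
  E (sym_part f) + E (fun y => skew_part f y * rademacher n y).
Proof.
move=> bf; rewrite Rintegral_distribution// -bRintegralD; last 2 first.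
- exact: bmeasurable_sym_part.
- by apply: bmeasurableM; [exact: bmeasurable_skew_part|exact: bmeasurable_rademacher].
by apply: eq_Rintegral => y _; exact: sym_skew_decomposition.
Qed.

Lemma Rintegral_uninformative f : bmeasurable f ->
  Rintegral uninformative setT f = E (sym_part f).
Proof.
move=> bf; rewrite Rintegral_distribution//.
set F := f \o _.
have bF : bmeasurable F by apply: bmeasurable_comp => //; exact: measurable_funPT.
(* Fubini, with the coin integrated first at fixed [y]: its mean is 0, so the skew part
   disappears. *)
rewrite /Rintegral -(integral21_prod_meas1 (bmeasurable_integrable (P \x P)%E bF)).
congr fine; apply: eq_integral => y _; rewrite /fubini_G.
transitivity ((E (fun s => sym_part f y + skew_part f y * rademacher 0 s))%:E).
  rewrite /Rintegral fineK.
    by apply: eq_integral => s _; rewrite /F /= -sym_skew_decomposition.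
  apply: integrable_fin_num => //; apply: bmeasurable_integrable.
  apply: bmeasurableD; first exact: bmeasurable_cst.
  exact/bmeasurableZ/bmeasurable_rademacher.
have br := @bmeasurable_rademacher R 0.
rewrite (bRintegralD P (bmeasurable_cst _) (bmeasurableZ _ br)).
by rewrite bRintegral_cst bRintegralZ// Rintegral_rademacher mulr0 addr0.
Qed.

Lemma cvg_Rintegral_informative f : bmeasurable f ->
  Rintegral (informative n) setT f @[n --> \oo] --> Rintegral uninformative setT f.
Proof.
move=> bf; under eq_fun do rewrite Rintegral_informative//.
rewrite Rintegral_uninformative//.
have := cvgD (cvg_cst (E (sym_part f)))
  (cvg_rademacher_coef (bmeasurable_skew_part bf)).
by rewrite addr0; apply.
Qed.

(** * The two modes of convergence and the common prior *)

Lemma weak_conv_informative : weak_conv informative uninformative.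
Proof.
move=> f cf [M fM]; apply: cvg_Rintegral_informative.
by split; [exact: continuous_measurable_fun3|exists M].
Qed.

Lemma probability_Rintegral d (S : measurableType d) (Q : probability S R)
    (A : set S) : measurable A -> Q A = (Rintegral Q setT (\1_A))%:E.
Proof.
by move=> mA; rewrite /Rintegral integral_indic// setIT fineK// fin_num_measure.
Qed.

Lemma setwise_conv_informative : setwise_conv informative uninformative.
Proof.
move=> A mA; rewrite probability_Rintegral//.
under eq_fun do rewrite probability_Rintegral//.
apply: cvg_EFin; first by near=> n.
exact/cvg_Rintegral_informative/bmeasurable_indic.
Unshelve. all: by end_near.
Qed.

Let measurable_state :
  measurable_fun setT (fst \o fst : (R * R) * R -> R).
Proof. exact: measurableT_comp. Qed.

(** Taken as the state marginal of [uninformative], so that only the marginals of [informative n]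
    call for a computation. *)
Definition coin_prior : probability R R :=
  distribution uninformative (mfun_Sub (mem_set measurable_state)).

Lemma x_marginal_uninformative : x_marginal uninformative coin_prior.
Proof.
move=> A mA; congr (uninformative _).
by apply/seteqP; split => [[[x y] z] /= [[]]|[[x y] z] //= Ax].
Qed.

Lemma x_marginal_informative n : x_marginal (informative n) coin_prior.
Proof.
move=> A mA; rewrite -x_marginal_uninformative//.
have mA3 : measurable ((A `*` [set: R]) `*` [set: R]).
  by apply: measurableX => //; exact: measurableX.
have b1 := bmeasurable_indic mA3.
rewrite !probability_Rintegral// Rintegral_informative// Rintegral_uninformative//.
have sliceE x y : \1_((A `*` [set: R]) `*` [set: R]) ((x, y), 0 : R) = \1_A x :> R.
  by rewrite !indicE; congr (nat_of_bool _)%:R; apply/idP/idP; rewrite !inE/= => // -[[]].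
(* The indicator of a cylinder over the state does not depend on [y], so its skew part is constant
   and the Fourier term is exactly 0 for every [n], not only in the limit. *)
rewrite (_ : (fun y => _) = fun y => 2^-1 * (\1_A 1 - \1_A (-1)) * rademacher n y).
  by rewrite (bRintegralZ P _ (bmeasurable_rademacher n)) Rintegral_rademacher mulr0 addr0.
by apply/funext => y; rewrite /skew_part !sliceE.
Qed.

(* Identity on the states [-1] and [1]; it makes the cost bounded on all of [R]. *)
Definition clamp (x : R) : R := Num.max (-1) (Num.min 1 x).

Lemma clamp_norm x : `|clamp x| <= 1.
Proof. by rewrite /clamp ler_norml le_max ge_max ge_min !lexx/= andbT; lra. Qed.

Lemma clamp1 : clamp 1 = 1.
Proof. by rewrite /clamp minxx; apply/max_idPr; lra. Qed.

Lemma clampN1 : clamp (-1) = -1.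
Proof. by rewrite /clamp (min_idPr _) ?maxxx//; lra. Qed.

Lemma continuous_clamp : continuous clamp.
Proof.
move=> x; apply: (@continuous_max R R (cst (-1)) (fun x => Num.min 1 x)).
  exact: cst_continuous.
by apply: (@continuous_min R R (cst 1) idfun) => //; exact: cst_continuous.
Qed.

(** * The game, its assumptions and its saddle values *)

Definition guess_game : zs_game R :=
  ZSGame (fun x u1 _ => clamp x * u1) `[-1, 1]%classic [set 0].

Lemma A2_guess_game : A2 guess_game.
Proof.
split; last first.
  exists 1 => x u1 u2 /=; rewrite in_itv/= -ler_norml => u1b _.
  by rewrite normrM mulr_ile1// clamp_norm.
apply: continuous_subspaceT => z /=.
apply: (@continuousM _ _ (fun z : (R * R) * R => clamp z.1.1) (fun z => z.1.2)).
  apply: continuous_comp; last exact: continuous_clamp.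
  by apply: (@continuous_comp _ _ _ fst fst); exact: cvg_fst.
by apply: (@continuous_comp _ _ _ fst snd); [exact: cvg_fst|exact: cvg_snd].
Qed.

Lemma A4_guess_game : A4 guess_game.
Proof. by split; [exact: segment_compact|exact: compact_set1]. Qed.

Lemma bmeasurable_guess_cost (g : R -> R) :
  policy (act1 guess_game) g ->
  bmeasurable (fun z : (R * R) * R => clamp z.1.1 * g z.1.2).
Proof.
move=> [mg gb]; apply: bmeasurableM.
  split; last by exists 1 => z; exact: clamp_norm.
  exact: measurableT_comp (continuous_measurable_fun continuous_clamp) measurable_state.
split; first by apply: measurableT_comp => //; exact: measurableT_comp.
by exists 1 => z; have := gb z.1.2; rewrite /= in_itv/= ler_norml.
Qed.

(** The cost is odd in the state: its symmetric part vanishes and its skew part is [g1]. *)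
Lemma Jcost_informative n g1 g2 : policy (act1 guess_game) g1 ->
  Jcost guess_game (informative n) g1 g2 = E (fun y => g1 y * rademacher n y).
Proof.
move=> pg1; rewrite /Jcost Rintegral_informative; last exact: bmeasurable_guess_cost.
rewrite (_ : sym_part _ = fun=> 0).
  rewrite bRintegral_cst add0r; congr (E _); apply/funext => y.
  by rewrite /skew_part /= clampN1 clamp1; congr (_ * _); field.
by apply/funext => y; rewrite /sym_part /= clampN1 clamp1; ring.
Qed.

Lemma Jcost_uninformative g1 g2 : policy (act1 guess_game) g1 ->
  Jcost guess_game uninformative g1 g2 = 0.
Proof.
move=> pg1; rewrite /Jcost Rintegral_uninformative; last exact: bmeasurable_guess_cost.
rewrite (_ : sym_part _ = fun=> 0) ?bRintegral_cst//.
by apply/funext => y; rewrite /sym_part /= clampN1 clamp1; ring.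
Qed.

Let zero_policy : policy (act2 guess_game) (fun=> 0).
Proof. by split. Qed.

Lemma saddle_value_informative n :
  saddle_value guess_game (informative n) (-1).
Proof.
have ppol : policy (act1 guess_game) (fun y => - rademacher n y).
  split; first exact: measurable_funN (proj1 (bmeasurable_rademacher n)).
  by move=> y /=; rewrite in_itv/=; case: (rademacher_pm1 n y) => ->; lra.
have Jopt g2 : Jcost guess_game (informative n) (fun y => - rademacher n y) g2 = -1.
  rewrite Jcost_informative// -[RHS](bRintegral_cst P).
  by congr (E _); apply/funext => y; rewrite mulNr rademacher_sqr.
exists (fun y => - rademacher n y), (fun=> 0); split => //; split => // g1 pg1.
(* Player 1's optimality holds pointwise: the integrand is at least -1 because [g1] takes values in
   [-1, 1]. Player 2's condition is an equality, the cost being independent of [u2]. *)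
rewrite Jopt Jcost_informative// -[leLHS](bRintegral_cst P).
apply: bRintegral_le; first exact: bmeasurable_cst.
  apply: bmeasurableM; last exact: bmeasurable_rademacher.
  case: pg1 => mg1 g1b; split => //; exists 1 => y.
  by have := g1b y; rewrite /= in_itv/= ler_norml.
move=> y; case: pg1 => _ /(_ y); rewrite /= in_itv/=.
by case: (rademacher_pm1 n y) => ->; lra.
Qed.

(** All policies give cost 0 here, so any pair is a saddle point; the zero policies are chosen. *)
Lemma saddle_value_uninformative : saddle_value guess_game uninformative 0.
Proof.
have ppol : policy (act1 guess_game) (fun=> 0).
  by split => // y /=; rewrite in_itv/=; lra.
exists (fun=> 0), (fun=> 0); split; last exact: Jcost_uninformative.
by split => // g1 pg1; rewrite !Jcost_uninformative.
Qed.

End Example.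

Theorem theorem3p1 (R : realType) :
  (exists (g : zs_game R) (zeta : probability R R)
          (mu_ : nat -> probability ((R * R) * R)%type R)
          (mu : probability ((R * R) * R)%type R) (v_ : nat -> R) (v : R),
      [/\ A2 g /\ A4 g, (forall n, x_marginal (mu_ n) zeta) /\ x_marginal mu zeta,
          weak_conv mu_ mu,
          (forall n, saddle_value g (mu_ n) (v_ n)) /\ saddle_value g mu v &
          ~ (v_ @ \oo --> v)]) /\
  (exists (g : zs_game R) (zeta : probability R R)
          (mu_ : nat -> probability ((R * R) * R)%type R)
          (mu : probability ((R * R) * R)%type R) (v_ : nat -> R) (v : R),
      [/\ A2 g /\ A4 g, (forall n, x_marginal (mu_ n) zeta) /\ x_marginal mu zeta,
          setwise_conv mu_ mu,
          (forall n, saddle_value g (mu_ n) (v_ n)) /\ saddle_value g mu v &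
          ~ (v_ @ \oo --> v)]).
Proof.
have not_cvg : ~ ((fun=> -1 : R) @ \oo --> (0 : R)).
  move=> /(cvg_lim (@Rhausdorff R)); rewrite lim_cst//.
  by move/eqP; rewrite oppr_eq0 oner_eq0.
split; exists guess_game, coin_prior, informative, uninformative, (fun=> -1), 0;
  split => //.
- by split; [exact: A2_guess_game|exact: A4_guess_game].
- by split; [exact: x_marginal_informative|exact: x_marginal_uninformative].
- exact: weak_conv_informative.
- by split; [exact: saddle_value_informative|exact: saddle_value_uninformative].
- by split; [exact: A2_guess_game|exact: A4_guess_game].
- by split; [exact: x_marginal_informative|exact: x_marginal_uninformative].
- exact: setwise_conv_informative.
- by split; [exact: saddle_value_informative|exact: saddle_value_uninformative].
Qed.
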